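(* Let $G = (L^2([0,1],\mathbb{R}),+)$ be the additive group of the real Hilbert space $L^2([0,1],\mathbb{R})$, regarded as an abelian Banach--Lie group, and let $\mathcal{H} = L^2([0,1],\mathbb{C})$. The unitary representation $\pi : G \to U(\mathcal{H})$ defined by $\pi(f)\xi = e^{if}\xi$ is continuous, but all its smooth vectors are trivial, i.e. $\mathcal{H}^\infty = \{0\}$.
   Context: $[0,1]$ carries Lebesgue measure, and $(e^{if}\xi)(t) = e^{if(t)}\xi(t)$ for almost every $t$. For a complex Hilbert space $\mathcal{H}$, $U(\mathcal{H})$ denotes its unitary group. A unitary representation $(\pi,\mathcal{H})$ of a Lie group $G$ (modeled on a locally convex space) is a group homomorphism $\pi : G \to U(\mathcal{H})$. It is called continuous if the action map $G \times \mathcal{H} \to \mathcal{H}$, $(g,v) \mapsto \pi(g)v$, is continuous; since $G$ acts by isometries, this is equivalent to continuity of all orbit maps $\pi^v : G \to \mathcal{H}$, $g \mapsto \pi(g)v$. The space of smooth vectors is $\mathcal{H}^\infty := \{ v \in \mathcal{H} : \pi^v \in C^\infty(G,\mathcal{H}) \}$. Here $G$ is a Hilbert space with its norm topology, and smoothness of $\pi^v$ is smoothness as a map between (real) Banach spaces. *)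

(* Defs.v *)
From HB Require Import structures.
From mathcomp Require Import all_boot all_order all_algebra.
From mathcomp Require Import generic_quotient ring_quotient.
From mathcomp Require Import all_classical all_reals all_analysis.
From mathcomp Require Import measurable_realfun complex.

Set Implicit Arguments.
Unset Strict Implicit.
Unset Printing Implicit Defensive.

Import Order.TTheory GRing.Theory Num.Def Num.Theory.
Import numFieldNormedType.Exports.
Import Quotient.Exports.
Import ComplexField.Normc.

Local Open Scope classical_set_scope.
Local Open Scope ring_scope.
Local Open Scope complex_scope.

(* [snull] is the kernel of the seminorm, given in the form in which it is used
   for the quotient (for L^2: the functions that vanish almost everywhere). *)
Record seminorm (K : numFieldType) (V : lmodType K) := Seminorm {
  snorm : V -> K;
  snull : {pred V};
  snormD : forall x y, snorm (x + y) <= snorm x + snorm y;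
  snormZ : forall (a : K) x, snorm (a *: x) = `|a| * snorm x;
  snullP : forall x, (x \in snull) <-> (snorm x = 0)
}.

Section SeminormQuotient.
Variables (K : numFieldType) (V : lmodType K) (p : seminorm V).
Local Notation N := (snull p).
Local Open Scope quotient_scope.

Lemma snorm0 : snorm p 0 = 0.
Proof. by rewrite -(scale0r 0) snormZ normr0 mul0r. Qed.

Lemma snormN x : snorm p (- x) = snorm p x.
Proof. by rewrite -scaleN1r snormZ normrN normr1 mul1r. Qed.

Lemma snorm_ge0 x : 0 <= snorm p x.
Proof.
rewrite -(@pmulrn_lge0 _ _ 2)// mulr2n -{2}(snormN x).
by rewrite (le_trans _ (snormD _ _ _))// subrr snorm0.
Qed.

Lemma snull_zmod_closed : zmod_closed N.
Proof.
split=> [|x y /snullP x0 /snullP y0]; first by apply/snullP/snorm0.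
apply/snullP/eqP; rewrite eq_le snorm_ge0 andbT.
by rewrite (le_trans (snormD _ _ _))// snormN x0 y0 addr0.
Qed.

HB.instance Definition _ := GRing.isZmodClosed.Build V (snull p)
  snull_zmod_closed.

Definition snquot : Type := Quotient.quot (N : zmodClosed V).

HB.instance Definition _ := Choice.on snquot.
HB.instance Definition _ := GRing.Zmodule.on snquot.

Definition snpi (x : V) : snquot := \pi_(Quotient.quot (N : zmodClosed V)) x.
Definition snrepr (q : snquot) : V := repr (q : Quotient.quot (N : zmodClosed V)).

Lemma snreprK : cancel snrepr snpi.
Proof. by move=> q; rewrite /snpi /snrepr reprK. Qed.

Lemma snpiP x y : snpi x = snpi y <-> (x - y \in N).
Proof.
by rewrite (Quotient.idealrBE (snull p)); split=> /eqP // /eqP ->.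
Qed.

Lemma snrepr_pi x : snrepr (snpi x) - x \in N.
Proof. by apply/snpiP; rewrite snreprK. Qed.

Lemma snpiB x y : snpi (x - y) = snpi x - snpi y.
Proof. by rewrite /snpi [in LHS]raddfB. Qed.

Lemma snpiD x y : snpi (x + y) = snpi x + snpi y.
Proof. by rewrite /snpi [in LHS]raddfD. Qed.

Lemma snorm_repr_pi x : snorm p (snrepr (snpi x)) = snorm p x.
Proof.
have /snullP e := snrepr_pi x.
have le y z : snorm p (y - z) = 0 -> snorm p y <= snorm p z.
  by move=> yz; rewrite -{1}(subrK z y) (le_trans (snormD _ _ _))// yz add0r.
by apply/eqP; rewrite eq_le !le// -opprB snormN.
Qed.

Definition snscale (a : K) (q : snquot) : snquot := snpi (a *: snrepr q).

Lemma snpiZ a x : snscale a (snpi x) = snpi (a *: x).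
Proof.
apply/snpiP/snullP; rewrite -scalerBr snormZ.
by have /snullP -> := snrepr_pi x; rewrite mulr0.
Qed.

Lemma snscaleA a b q : snscale a (snscale b q) = snscale (a * b) q.
Proof. by rewrite -[q]snreprK !snpiZ scalerA. Qed.
Lemma snscale1 : left_id 1 snscale.
Proof. by move=> q; rewrite -[q]snreprK snpiZ scale1r. Qed.
Lemma snscaleDr : right_distributive snscale +%R.
Proof.
by move=> a q r; rewrite -[q]snreprK -[r]snreprK -snpiD !snpiZ scalerDr snpiD.
Qed.
Lemma snscaleDl q : {morph snscale ^~ q : a b / a + b}.
Proof. by move=> a b; rewrite -[q]snreprK !snpiZ scalerDl snpiD. Qed.

HB.instance Definition _ := GRing.Zmodule_isLmodule.Build K snquot
  snscaleA snscale1 snscaleDr snscaleDl.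

Definition snquot_norm (q : snquot) : K := snorm p (snrepr q).

Lemma snquot_normD q r :
  snquot_norm (q + r) <= snquot_norm q + snquot_norm r.
Proof.
rewrite /snquot_norm -[q in X in X <= _]snreprK -[r in X in X <= _]snreprK.
by rewrite -snpiD snorm_repr_pi snormD.
Qed.

Lemma snquot_normZ a q : snquot_norm (a *: q) = `|a| * snquot_norm q.
Proof. by rewrite /snquot_norm [a *: q]/(snpi _) snorm_repr_pi snormZ. Qed.

Lemma snquot_norm_eq0 q : snquot_norm q = 0 -> q = 0.
Proof.
move=> /snullP q0; rewrite -[q]snreprK -(subrr (snpi 0)) -snpiB subr0.
by apply/snpiP; rewrite subr0.
Qed.

HB.instance Definition _ := @Lmodule_isNormed.Build K snquot
  snquot_norm snquot_normD snquot_normZ snquot_norm_eq0.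

End SeminormQuotient.

Section L2.
Variable R : realType.
Local Notation T := (measurableTypeR R).
Local Notation ReC := (@complex.Re R).
Local Notation ImC := (@complex.Im R).

(* Functions are defined on the whole line, but this measure ignores their
   values outside [0,1]. *)
Definition mu01 : {measure set T -> \bar R} :=
  mrestr (@lebesgue_measure R) (measurable_itv `[(0 : R), 1]).

Lemma measurable_pow2 (g : T -> R) : measurable_fun setT g ->
  measurable_fun setT (fun t => `|(g t)%:E| `^ 2%:R)%E.
Proof.
move=> mg; apply: (@measurableT_comp _ _ _ _ _ _ (fun x => x `^ 2%:R)%E).
  exact: measurable_poweR.
by apply/measurable_EFinP/measurableT_comp.
Qed.

Lemma Lnorm2_ae0 (g : T -> R) : measurable_fun setT g ->
  g = cst 0 %[ae mu01] -> 'N[mu01]_2%:R%:E[EFin \o g]%E = 0%E.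
Proof.
move=> mg g0; rewrite unlock (ae_eq_integral (cst 0%E)) => //.
- by rewrite integral0 poweR0r// invr_eq0 pnatr_eq0.
- exact: measurable_pow2.
- apply: filterS g0 => x /= gx _; rewrite gx//=.
  by rewrite normr0 powR0// pnatr_eq0.
Qed.

Lemma le_Lnorm2 (g h : T -> R) : measurable_fun setT g -> measurable_fun setT h ->
  (forall t, `|g t| <= `|h t|) ->
  ('N[mu01]_2%:R%:E[EFin \o g] <= 'N[mu01]_2%:R%:E[EFin \o h])%E.
Proof.
move=> mg mh gh; rewrite unlock; apply: gt0_ler_poweR.
- by rewrite invr_ge0.
- by rewrite in_itv/= integral_ge0//= ?leey// => x _; exact: poweR_ge0.
- by rewrite in_itv/= integral_ge0//= ?leey// => x _; exact: poweR_ge0.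
apply: ge0_le_integral => //.
- by move=> x _; exact: poweR_ge0.
- exact: measurable_pow2.
- exact: measurable_pow2.
- by move=> x _ /=; rewrite lee_fin ge0_ler_powR// nnegrE.
Qed.

Definition L2R_fun := LfunType mu01 (lee1n 2).

Definition L2R_snorm (f : L2R_fun) : R := fine 'N[mu01]_2%:R%:E[EFin \o f]%E.

Definition L2R_null : {pred L2R_fun} :=
  fun f => `[< (f : T -> R) = cst 0 %[ae mu01] >].

Lemma L2R_snormZ (a : R) (f : L2R_fun) :
  L2R_snorm (a *: f) = `|a| * L2R_snorm f.
Proof. by apply: EFin_inj; rewrite EFinM !finite_norm_fine; exact: LnormZ. Qed.

Lemma L2R_nullP (f : L2R_fun) : (f \in L2R_null) <-> (L2R_snorm f = 0).
Proof.
split=> [/asboolP f0|/fine_Lnormr_eq0 f0]; last by apply/asboolP.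
by rewrite /L2R_snorm Lnorm2_ae0.
Qed.

Definition L2R_seminorm : seminorm L2R_fun :=
  Seminorm (@ler_LnormD _ _ _ mu01 _ (lee1n 2)) L2R_snormZ L2R_nullP.

Definition L2R : Type := snquot L2R_seminorm.
HB.instance Definition _ := NormedModule.on L2R.

Definition L2R_val (f : L2R) : R -> R := snrepr f.

Definition measurable_complex (f : T -> R[i]) :=
  measurable_fun setT (ReC \o f) /\ measurable_fun setT (ImC \o f).

Definition L2C_pred : {pred T -> R[i]} := fun f =>
  `[< measurable_complex f /\
      finite_norm mu01 2%:R%:E ((@normc R : R[i] -> R) \o f) >].

Lemma normcE (z : R[i]) : normc z = Num.sqrt (ReC z ^+ 2 + ImC z ^+ 2).
Proof. by case: z. Qed.

Lemma measurable_normc f : measurable_complex f ->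
  measurable_fun setT ((@normc R : R[i] -> R) \o f).
Proof.
move=> [mr mi].
rewrite (_ : _ \o f = (fun t => (ReC (f t) ^+ 2 + ImC (f t) ^+ 2) `^ 2^-1)).
  apply: (measurableT_comp (measurable_powR _)).
  by apply: measurable_funD; apply: measurable_funX.
by apply/funext => t /=; rewrite normcE powR12_sqrt// addr_ge0 ?sqr_ge0.
Qed.

Record L2C_fun := MkL2C {
  L2C_fun_val :> T -> R[i];
  L2C_funP : L2C_fun_val \in L2C_pred
}.
HB.instance Definition _ := [isSub for L2C_fun_val].
HB.instance Definition _ := [Choice of L2C_fun by <:].

Lemma measurable_complexD f g : measurable_complex f -> measurable_complex g ->
  measurable_complex (f + g).
Proof.
move=> [fr fi] [gr gi]; split.
  rewrite (_ : _ \o _ = (ReC \o f) \+ (ReC \o g)); first exact: measurable_funD.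
  by apply/funext => t /=; rewrite /GRing.add /=; case: (f t) (g t) => [? ?] [].
rewrite (_ : _ \o _ = (ImC \o f) \+ (ImC \o g)); first exact: measurable_funD.
by apply/funext => t /=; rewrite /GRing.add /=; case: (f t) (g t) => [? ?] [].
Qed.

Lemma measurable_complexM f g : measurable_complex f -> measurable_complex g ->
  measurable_complex (fun t => f t * g t).
Proof.
move=> [fr fi] [gr gi]; split.
  rewrite (_ : _ \o _ = (ReC \o f) \* (ReC \o g) \- (ImC \o f) \* (ImC \o g)).
    by apply: measurable_funB; exact: measurable_funM.
  by apply/funext => t /=; case: (f t) (g t) => [? ?] [].
rewrite (_ : _ \o _ = (ReC \o f) \* (ImC \o g) \+ (ImC \o f) \* (ReC \o g)).
  by apply: measurable_funD; exact: measurable_funM.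
by apply/funext => t /=; case: (f t) (g t) => [? ?] [].
Qed.

Lemma measurable_complex_cst (a : R[i]) : measurable_complex (cst a).
Proof. by split; exact: measurable_cst. Qed.

Lemma L2C_modP f : f \in L2C_pred ->
  (((@normc R : R[i] -> R) \o f : T -> R) \in Lfun mu01 2%:R%:E)%R.
Proof.
move=> /asboolP[mf ff]; apply/andP; split; apply/mem_set => //.
exact: measurable_normc.
Qed.

Definition L2_modulus f (Pf : f \in L2C_pred) : L2R_fun :=
  Lfun_Sub (lee1n 2) (L2C_modP Pf).

Lemma normcD (x y : R[i]) : normc (x + y) <= normc x + normc y.
Proof. exact: (@ler_normD R (Rcomplex R)). Qed.

Lemma L2C_dom (f : T -> R[i]) (h : L2R_fun) : measurable_complex f ->
  (forall t, normc (f t) <= h t) ->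
  ('N[mu01]_2%:R%:E[EFin \o ((@normc R : R[i] -> R) \o f)] <=
   'N[mu01]_2%:R%:E[EFin \o h])%E.
Proof.
move=> mf fh; apply: le_Lnorm2 => //; first exact: measurable_normc.
have normc_ge0 z : 0 <= normc z :> R by rewrite normcE sqrtr_ge0.
by move=> t; rewrite /= !ger0_norm// (le_trans _ (fh t)).
Qed.

Lemma L2C_submod_closed : submod_closed L2C_pred.
Proof.
split=> [|a f g].
  apply/asboolP; split; first exact: (measurable_complex_cst 0).
  rewrite /finite_norm Lnorm2_ae0//.
    exact: (@measurable_normc 0 (measurable_complex_cst 0)).
  by apply: nearW => t _; exact: normc0.
move=> Pf Pg; have /asboolP[mf _] := Pf; have /asboolP[mg _] := Pg.
have mfg : measurable_complex (a *: f + g).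
  apply: measurable_complexD => //.
  exact: measurable_complexM (measurable_complex_cst a) mf.
apply/asboolP; split=> //.
apply: (le_lt_trans (L2C_dom (h := normc a *: L2_modulus Pf + L2_modulus Pg) _ _)) => //.
- by move=> t /=; rewrite (le_trans (normcD _ _))// normcM.
- exact: Lfunction_finite.
Qed.
HB.instance Definition _ :=
  GRing.isSubmodClosed.Build _ _ L2C_pred L2C_submod_closed.
HB.instance Definition _ := [SubChoice_isSubLmodule of L2C_fun by <:].

Definition L2C_snorm (f : L2C_fun) : R[i] :=
  (fine 'N[mu01]_2%:R%:E[EFin \o ((@normc R : R[i] -> R) \o f)]%E)%:C.

Definition L2C_null : {pred L2C_fun} :=
  fun f => `[< (f : T -> R[i]) = cst 0 %[ae mu01] >].

Lemma L2C_snormE f : L2C_snorm f = (L2R_snorm (L2_modulus (L2C_funP f)))%:C.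
Proof. by []. Qed.

Lemma L2C_snormD f g : L2C_snorm (f + g) <= L2C_snorm f + L2C_snorm g.
Proof.
rewrite !L2C_snormE -rmorphD lecR.
apply: (le_trans _ (ler_LnormD (L2_modulus (L2C_funP f))
                               (L2_modulus (L2C_funP g)))).
rewrite -lee_fin !finite_norm_fine.
have /asboolP[mfg _] := L2C_funP (f + g).
by apply: L2C_dom => // t; exact: normcD.
Qed.

Lemma L2C_snormZ (a : R[i]) f : L2C_snorm (a *: f) = `|a| * L2C_snorm f.
Proof.
rewrite !L2C_snormE (_ : `|a| = (normc a)%:C)// -rmorphM; congr (_%:C).
have <- : `|normc a| = normc a by rewrite ger0_norm// normcE sqrtr_ge0.
rewrite -L2R_snormZ /L2R_snorm; congr (fine _); apply: eq_Lnorm => t /=.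
by congr (_%:E); exact: normcM.
Qed.

Lemma L2C_nullP f : (f \in L2C_null) <-> (L2C_snorm f = 0).
Proof.
rewrite L2C_snormE; split=> [/asboolP f0|[]].
  congr (_%:C); apply/L2R_nullP/asboolP.
  by apply: filterS f0 => t /= f0 _; rewrite f0// normc0.
move=> /L2R_nullP/asboolP f0; apply/asboolP.
by apply: filterS f0 => t /= f0 _; apply/eq0_normc/f0.
Qed.

Definition L2C_seminorm : seminorm L2C_fun :=
  Seminorm L2C_snormD L2C_snormZ L2C_nullP.

Definition L2C : Type := snquot L2C_seminorm.
HB.instance Definition _ := NormedModule.on L2C.

(* A representative of the class; equalities between such values are meaningful
   only almost everywhere. *)
Definition L2C_val (xi : L2C) : R -> R[i] := snrepr xi.

Definition L2C_inner (xi eta : L2C) : R[i] :=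
  let h t := L2C_val xi t * (L2C_val eta t)^* in
  (\int[mu01]_t (ReC (h t)))%R +i* (\int[mu01]_t (ImC (h t)))%R.

Lemma L2C_inner_norm (xi : L2C) : L2C_inner xi xi = `|xi| ^+ 2.
Proof.
have -> : `|xi| = L2C_snorm (snrepr xi) by [].
rewrite L2C_snormE -rmorphXn; set h := L2_modulus _.
have hE t : h t = normc (L2C_val xi t) by [].
rewrite /L2C_inner; congr (_ +i* _).
  transitivity (\int[mu01]_t (h t ^+ 2))%R.
    apply: eq_Rintegral => t _; rewrite hE normcE.
    rewrite sqr_sqrtr ?addr_ge0 ?sqr_ge0//.
    by case: (L2C_val xi t) => x y /=; rewrite mulrN opprK -!expr2.
  rewrite -[RHS](@powR_mulrn _ _ 2) ?fine_ge0 ?Lnorm_ge0// -fine_poweR.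
  rewrite powR_Lnorm ?pnatr_eq0// /Rintegral; congr fine.
  apply: eq_integral => t _ /=; congr (_%:E).
  by rewrite powR_mulrn// real_normK// num_real.
apply: (etrans _ (_ : (\int[mu01]_t (0 : R))%R = 0)); last first.
  by rewrite /Rintegral integral0.
apply: eq_Rintegral => t _.
by case: (L2C_val xi t) => x y /=; rewrite mulrN mulrC addNr.
Qed.

(* e^{ix} *)
Definition expi (x : R) : R[i] := cos x +i* sin x.

Lemma normc_expi x : normc (expi x) = 1.
Proof. by rewrite normcE /= cos2Dsin2 sqrtr1. Qed.

Lemma L2C_expi_mulP (f : L2R) (xi : L2C) :
  (fun t : T => expi (L2R_val f t) * L2C_val xi t) \in L2C_pred.
Proof.
have /asboolP[mxi xifin] := L2C_funP (snrepr xi).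
have mf : measurable_fun setT (snrepr f : T -> R) by [].
apply/asboolP; split.
  apply: (@measurable_complexM (fun t => expi (L2R_val f t)) (L2C_val xi)) => //.
  split.
    apply: (@measurableT_comp _ _ _ _ _ _ (@cos R) _ (L2R_val f)) => //.
    by apply: continuous_measurable_fun => x; exact: continuous_cos.
  apply: (@measurableT_comp _ _ _ _ _ _ (@sin R) _ (L2R_val f)) => //.
  by apply: continuous_measurable_fun => x; exact: continuous_sin.
rewrite /finite_norm; congr (_ < _)%E: xifin; apply: eq_Lnorm => t /=.
by rewrite normcM normc_expi mul1r.
Qed.

Definition L2C_expi_mul (f : L2R) (xi : L2C) : L2C :=
  snpi L2C_seminorm (MkL2C (L2C_expi_mulP f xi)).

Lemma L2C_expi_mulE f xi :
  {ae mu01, forall t, L2C_val (L2C_expi_mul f xi) t =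
                      expi (L2R_val f t) * L2C_val xi t}.
Proof.
have /asboolP := snrepr_pi L2C_seminorm (MkL2C (L2C_expi_mulP f xi)).
by apply: filterS => t /(_ I) /= /eqP; rewrite subr_eq0 => /eqP.
Qed.

End L2.

Section ContinuousLinearMaps.
Variables (R : realType) (E F : normedModType R).

Definition clin_pred : {pred E -> F} := fun f => `[< linear f /\ continuous f >].

Record clin := MkClin { clin_fun :> E -> F; clinP : clin_fun \in clin_pred }.
HB.instance Definition _ := [isSub for clin_fun].
HB.instance Definition _ := [Choice of clin by <:].

Lemma clin_submod_closed : submod_closed clin_pred.
Proof.
split=> [|a f g /asboolP[fl fc] /asboolP[gl gc]]; apply/asboolP; split.
- by move=> a x y; rewrite /= scaler0 addr0.
- by move=> x; exact: cvg_cst.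
- move=> b x y.
  have fgE z : (a *: f + g) z = a *: f z + g z by [].
  by rewrite !fgE fl gl !scalerDr !scalerA [a * b]mulrC addrACA.
- move=> x; apply: cvgD; last exact: gc.
  by apply: cvgZr; exact: fc.
Qed.
HB.instance Definition _ :=
  GRing.isSubmodClosed.Build _ _ clin_pred clin_submod_closed.
HB.instance Definition _ := [SubChoice_isSubLmodule of clin by <:].

Definition opnorm (f : clin) : R := sup [set `|f x| | x in [set x | `|x| <= 1]].

Lemma clin_bounded (f : clin) : exists M, forall x, `|f x| <= M * `|x|.
Proof.
have /asboolP[fl fc] := clinP f.
pose g : {linear E -> F} := HB.pack (clin_fun f) (GRing.isLinear.Build _ _ _ _ _ fl).
have /linear_boundedP/pinfty_ex_gt0[M M0 fM] : bounded_near g (nbhs (0 : E)).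
  exact/linear_bounded_continuous.
by exists M.
Qed.

Lemma opnorm_has_sup (f : clin) :
  has_sup [set `|f x| | x in [set x | `|x| <= 1]].
Proof.
have [M fM] := clin_bounded f; split.
  by exists `|f 0|; exists 0 => //=; rewrite normr0.
exists `|M| => _ [x /= x1 <-].
rewrite (le_trans (fM x))// (le_trans (ler_norm _))// normrM normr_id.
by rewrite ler_piMr.
Qed.

Lemma clinZ (f : clin) a x : f (a *: x) = a *: f x.
Proof.
have /asboolP[fl _] := clinP f.
have f0 : f 0 = 0.
  by apply: (addrI (f 0)); rewrite -{1}[f 0]scale1r -fl scale1r !addr0.
by rewrite -[a *: x]addr0 fl f0 addr0.
Qed.

Lemma opnorm_ge0 f : 0 <= opnorm f.
Proof.
apply: (le_trans (normr_ge0 (f 0))); apply: ub_le_sup.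
  by have [] := opnorm_has_sup f.
by exists 0 => //=; rewrite normr0.
Qed.

Lemma le_opnorm (f : clin) x : `|f x| <= opnorm f * `|x|.
Proof.
have [->|x0] := eqVneq x 0.
  by rewrite -(scale0r 0) clinZ !scale0r !normr0 mulr0.
rewrite -ler_pdivrMr ?normr_gt0//.
have -> : `|f x| / `|x| = `|f (`|x|^-1 *: x)|.
  by rewrite clinZ normrZ normfV normr_id mulrC.
apply: ub_le_sup; first by have [] := opnorm_has_sup f.
by exists (`|x|^-1 *: x) => //=; rewrite normrZ normfV normr_id mulVf ?normr_eq0.
Qed.

Lemma opnorm_le (f : clin) M : 0 <= M -> (forall x, `|f x| <= M * `|x|) ->
  opnorm f <= M.
Proof.
move=> M0 fM; apply: ge_sup; first by have [] := opnorm_has_sup f.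
move=> _ [x /= x1 <-]; rewrite (le_trans (fM x))//.
by rewrite ler_piMr.
Qed.

Lemma opnormD f g : opnorm (f + g) <= opnorm f + opnorm g.
Proof.
apply: opnorm_le => [|x]; first by rewrite addr_ge0// opnorm_ge0.
by rewrite (le_trans (ler_normD _ _))// mulrDl lerD// le_opnorm.
Qed.

Lemma opnormZ a f : opnorm (a *: f) = `|a| * opnorm f.
Proof.
have le b g : opnorm (b *: g) <= `|b| * opnorm g.
  apply: opnorm_le => [|x]; first by rewrite mulr_ge0// opnorm_ge0.
  by rewrite [X in `|X|]/(b *: g x) normrZ -mulrA ler_wpM2l// le_opnorm.
apply/eqP; rewrite eq_le le/=.
have [->|a0] := eqVneq a 0; first by rewrite normr0 mul0r opnorm_ge0.
rewrite -ler_pdivlMl ?normr_gt0// -normfV.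
by rewrite (le_trans _ (le _ _))// scalerA mulVf// scale1r.
Qed.

Lemma opnorm_eq0 f : opnorm f = 0 -> f = 0.
Proof.
move=> f0; apply/val_inj/funext => x; apply/normr0_eq0/eqP.
by rewrite eq_le normr_ge0 andbT (le_trans (le_opnorm f x))// f0 mul0r.
Qed.

HB.instance Definition _ :=
  @Lmodule_isNormed.Build R clin opnorm opnormD opnormZ opnorm_eq0.

(* 'd f x is the Frechet derivative; the default value is used only when it is
   not continuous, hence never at a point of differentiability. *)
Definition fderiv (f : E -> F) (x : E) : clin := insubd 0 ('d f x : E -> F).

Lemma fderivE f x : differentiable f x -> fderiv f x = 'd f x :> (E -> F).
Proof.
move=> df; apply: (@insubdK _ _ clin 0); apply/asboolP; split.
  exact: linearP.
exact: diff_continuous.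
Qed.

End ContinuousLinearMaps.

(* Frechet sense: C^{n+1} means differentiable with a C^n derivative, the
   derivative taking values in the continuous linear maps with operator norm. *)
Fixpoint Cn (R : realType) (E : normedModType R) (n : nat) :
    forall F : normedModType R, (E -> F) -> Prop :=
  match n with
  | 0 => fun F f => continuous f
  | n'.+1 => fun F f =>
      (forall x, differentiable f x) /\ @Cn R E n' (clin E F) (fderiv f)
  end.

Definition smooth (R : realType) (E F : normedModType R) (f : E -> F) :=
  forall n, Cn n f.

Section Realification.
Variables (R : realType) (H : normedModType R[i]).

(* The real normed space underlying a complex one: same vectors, scalars
   restricted to R, norm taken in R instead of in the real line of R[i]. *)
Definition realified : Type := H.
HB.instance Definition _ := GRing.Zmodule.copy realified H.

Definition realified_scale (a : R) (x : realified) : realified :=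
  a%:C *: (x : H).

Lemma realified_scaleA a b x :
  realified_scale a (realified_scale b x) = realified_scale (a * b) x.
Proof. by rewrite /realified_scale scalerA -rmorphM. Qed.
Lemma realified_scale1 : left_id 1 realified_scale.
Proof. by move=> x; rewrite /realified_scale rmorph1 scale1r. Qed.
Lemma realified_scaleDr : right_distributive realified_scale +%R.
Proof. by move=> a x y; exact: scalerDr. Qed.
Lemma realified_scaleDl x : {morph realified_scale ^~ x : a b / a + b}.
Proof. by move=> a b; rewrite /realified_scale rmorphD; exact: scalerDl. Qed.

HB.instance Definition _ := GRing.Zmodule_isLmodule.Build R realified
  realified_scaleA realified_scale1 realified_scaleDr realified_scaleDl.

Definition realified_norm (x : realified) : R := complex.Re `|x : H|.

Lemma realified_normE x : (realified_norm x)%:C = `|x : H|.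
Proof. exact/RRe_real/normr_real. Qed.

Lemma realified_normD x y :
  realified_norm (x + y) <= realified_norm x + realified_norm y.
Proof. by rewrite -lecR rmorphD/= !realified_normE ler_normD. Qed.

Lemma realified_normZ a x :
  realified_norm (a *: x) = `|a| * realified_norm x.
Proof.
apply: (@complexI R); rewrite rmorphM/= !realified_normE.
by rewrite [a *: x]/(a%:C *: (x : H)) normrZ normc_def/= expr0n addr0 sqrtr_sqr.
Qed.

Lemma realified_norm_eq0 x : realified_norm x = 0 -> x = 0.
Proof. by move=> x0; apply/(@normr0_eq0 _ H); rewrite -realified_normE x0. Qed.

HB.instance Definition _ := @Lmodule_isNormed.Build R realified
  realified_norm realified_normD realified_normZ realified_norm_eq0.

End Realification.

Section Representations.
Variable R : realType.
Implicit Types (G : normedModType R) (U : L2C R -> L2C R).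

Definition unitary U :=
  [/\ linear U, bijective U &
      forall xi eta, L2C_inner (U xi) (U eta) = L2C_inner xi eta].

Definition unitary_rep G (pi : G -> L2C R -> L2C R) :=
  (forall g, unitary (pi g)) /\ (forall g h, pi (g + h) = pi g \o pi h).

Definition continuous_rep G (pi : G -> L2C R -> L2C R) :=
  continuous (fun p : G * L2C R => pi p.1 p.2).

Definition smooth_vectors G (pi : G -> L2C R -> L2C R) : set (L2C R) :=
  [set v | smooth (fun g => pi g v : realified (L2C R))].

End Representations.

(* Main.v *)
(* Continuity: for fixed xi split xi = xi 1_{|xi| <= M} + xi 1_{|xi| > M}.  The
   second part has small norm for M large, and on the first one the inequality
   |e^{ix} - 1| <= |x| bounds the variation of f |-> e^{if} xi by M times the
   distance.

   Smooth vectors: the orbit map F of xi <> 0 is not even differentiable at 0.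
   Indeed |xi| >= d > 0 on a set of positive measure, which contains sets A of
   arbitrarily small positive measure.  For h = pi 1_A the second difference
   F h + F (- h) - 2 F 0 equals -4 xi on A and 0 elsewhere, so its norm is at
   least (4 d / pi) |h|, whereas differentiability would make it o(|h|). *)
Require Import Defs.
From mathcomp Require Import all_boot all_order all_algebra.
From mathcomp Require Import all_classical all_reals all_analysis.
From mathcomp Require Import measurable_realfun complex ring lra.
Set Implicit Arguments.
Unset Strict Implicit.
Unset Printing Implicit Defensive.
Import Order.TTheory GRing.Theory Num.Def Num.Theory.
Import numFieldNormedType.Exports.
Import ComplexField.Normc.
Local Open Scope classical_set_scope.
Local Open Scope ring_scope.

(** * Almost-everywhere calculus of representatives in L^2 *)

Section L2Classes.
Variable R : realType.
Local Notation T := (measurableTypeR R).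
Implicit Types (f g : L2R R) (xi eta : L2C R) (t : T).

Lemma normc_ge0 (z : R[i]) : 0 <= normc z :> R.
Proof. by rewrite Defs.normcE sqrtr_ge0. Qed.

Lemma ae_le_Lnorm2 (g h : T -> R) :
  measurable_fun setT g -> measurable_fun setT h ->
  {ae @mu01 R, forall t, `|g t| <= `|h t|} ->
  ('N[@mu01 R]_2%:R%:E[EFin \o g] <= 'N[@mu01 R]_2%:R%:E[EFin \o h])%E.
Proof.
move=> mg mh gh; rewrite unlock; apply: gt0_ler_poweR.
- by rewrite invr_ge0.
- by rewrite in_itv/= integral_ge0//= ?leey// => x _; exact: poweR_ge0.
- by rewrite in_itv/= integral_ge0//= ?leey// => x _; exact: poweR_ge0.
apply: ae_ge0_le_integral => //.
- by move=> x _; exact: poweR_ge0.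
- exact: measurable_pow2.
- by move=> x _; exact: poweR_ge0.
- exact: measurable_pow2.
- by apply: filterS gh => x gh _ /=; rewrite lee_fin ge0_ler_powR// nnegrE.
Qed.

(** The representative chosen from the class of [u] need not be [u] itself; the two differ by an
    element of the null space. *)
Lemma L2R_val_pi (u : L2R_fun R) :
  {ae @mu01 R, forall t, L2R_val (snpi (L2R_seminorm R) u) t = u t}.
Proof.
have /asboolP := snrepr_pi (L2R_seminorm R) u.
by apply: filterS => t /(_ I) /= /eqP; rewrite subr_eq0 => /eqP.
Qed.

Lemma L2C_val_pi (u : L2C_fun R) :
  {ae @mu01 R, forall t, L2C_val (snpi (L2C_seminorm R) u) t = u t}.
Proof.
have /asboolP := snrepr_pi (L2C_seminorm R) u.
by apply: filterS => t /(_ I) /= /eqP; rewrite subr_eq0 => /eqP.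
Qed.

Lemma L2R_valD f g :
  {ae @mu01 R, forall t, L2R_val (f + g) t = L2R_val f t + L2R_val g t}.
Proof.
rewrite -[f in f + g]snreprK -[g in _ + g]snreprK -snpiD; exact: L2R_val_pi.
Qed.

Lemma L2R_val0 : {ae @mu01 R, forall t, L2R_val (0 : L2R R) t = 0}.
Proof.
rewrite -(subrr (snpi (L2R_seminorm R) 0)) -snpiB subr0; exact: L2R_val_pi.
Qed.

Lemma L2R_valN f : {ae @mu01 R, forall t, L2R_val (- f) t = - L2R_val f t}.
Proof.
apply: filterS2 (L2R_valD f (- f)) L2R_val0 => t.
by rewrite subrr => -> /eqP; rewrite addrC addr_eq0 => /eqP.
Qed.

Lemma L2C_valD xi eta :
  {ae @mu01 R, forall t, L2C_val (xi + eta) t = L2C_val xi t + L2C_val eta t}.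
Proof.
rewrite -[xi in xi + eta]snreprK -[eta in _ + eta]snreprK -snpiD.
exact: L2C_val_pi.
Qed.

Lemma L2C_valZ a xi :
  {ae @mu01 R, forall t, L2C_val (a *: xi) t = a * L2C_val xi t}.
Proof.
rewrite -[xi in a *: xi]snreprK [a *: _]snpiZ; exact: L2C_val_pi.
Qed.

Lemma L2C_valN xi : {ae @mu01 R, forall t, L2C_val (- xi) t = - L2C_val xi t}.
Proof.
by rewrite -scaleN1r; apply: filterS (L2C_valZ (-1) xi) => t ->; rewrite mulN1r.
Qed.

(* [L2C_expi_mulE] quantifies over [R]; only for the carrier of the measurable
   space is the almost-everywhere filter found by inference. *)
Lemma L2C_val_expi_mul f xi : {ae @mu01 R, forall t : T,
  L2C_val (L2C_expi_mul f xi) t = expi (L2R_val f t) * L2C_val xi t}.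
Proof. exact: L2C_expi_mulE. Qed.

Lemma L2C_val_inj xi eta :
  {ae @mu01 R, forall t, L2C_val xi t = L2C_val eta t} -> xi = eta.
Proof.
move=> e; rewrite -[xi]snreprK -[eta]snreprK; apply/snpiP/asboolP.
by apply: filterS e => t et _; apply/eqP; rewrite subr_eq0; exact/eqP.
Qed.

Lemma L2C_val0 : {ae @mu01 R, forall t, L2C_val (0 : L2C R) t = 0}.
Proof.
rewrite -(subrr (snpi (L2C_seminorm R) 0)) -snpiB subr0; exact: L2C_val_pi.
Qed.

Lemma L2R_val_measurable f : measurable_fun setT (L2R_val f : T -> R).
Proof. by []. Qed.

Lemma L2C_val_measurable xi : measurable_complex (L2C_val xi).
Proof. by have /asboolP[] := L2C_funP (snrepr xi). Qed.

End L2Classes.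

(** * Elementary estimates for e^{ix} *)

Section ExpI.
Variable R : realType.
Implicit Types x y : R.

Lemma expiD x y : expi (x + y) = expi x * expi y.
Proof.
apply/eqP; rewrite eq_complex /= cosD sinD eqxx /=.
by rewrite addrC mulrC [sin x * _]mulrC.
Qed.

Lemma expi0 : expi 0 = 1 :> R[i].
Proof. by rewrite /expi cos0 sin0. Qed.

Lemma ler_norm_sin x : `|sin x| <= `|x|.
Proof.
wlog x0 : x / 0 <= x => [sinle|].
  have [/sinle//|/ltW x0] := leP 0 x.
  by rewrite -normrN -sinN -[leRHS]normrN sinle// oppr_ge0.
(* The mean value theorem on [0, x] gives sin x = x cos c, and |cos c| <= 1. *)
have csin : {within `[0, x], continuous (@sin R)}.
  by apply: continuous_subspaceT => y; exact: continuous_sin.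
have [c _] := MVT_segment x0 (fun y _ => is_derive_sin y) csin.
by rewrite sin0 !subr0 => ->; rewrite normrM ler_piMl// cos_max.
Qed.

(** The squared modulus is 2 - 2 cos x = 4 sin^2 (x/2), and |sin (x/2)| <= |x/2|. *)
Lemma normc_expiB1 x : normc (expi x - 1) <= `|x|.
Proof.
rewrite -[leRHS]sqrtr_sqr Defs.normcE ler_wsqrtr//=.
rewrite subr0 sin2cos2 [x in cos x](_ : x = (x / 2) *+ 2); last first.
  by rewrite -mulr_natr divfK.
rewrite cos_mulr2n cos2sin2.
have := ler_norm_sin (x / 2); rewrite -ler_sqr ?nnegrE// !real_normK ?num_real//.
nra.
Qed.

Lemma normc_expiB1_le2 x : normc (expi x - 1) <= 2.
Proof.
rewrite (le_trans (normcD _ _))// normc_expi.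
by rewrite Defs.normcE /= oppr0 sqrrN expr1n expr0n addr0 sqrtr1; lra.
Qed.

End ExpI.

(** * Multiplication by e^{if} as a unitary representation *)

Section UnitaryRep.
Variable R : realType.
Local Notation T := (measurableTypeR R).

Lemma L2C_expi_mul_linear (f : L2R R) : linear (L2C_expi_mul f).
Proof.
move=> a xi eta; apply: L2C_val_inj.
(* [t] stays outside a finite union of null sets, one for each pointwise identity rewritten
   below. *)
near=> t.
have -> : L2C_val (L2C_expi_mul f (a *: xi + eta)) t =
    expi (L2R_val f t) * L2C_val (a *: xi + eta) t.
  by near: t; exact: L2C_val_expi_mul.
have -> : L2C_val (a *: xi + eta) t = L2C_val (a *: xi) t + L2C_val eta t.
  by near: t; exact: L2C_valD.
have -> : L2C_val (a *: xi) t = a * L2C_val xi t by near: t; exact: L2C_valZ.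
have -> : L2C_val (a *: L2C_expi_mul f xi + L2C_expi_mul f eta) t =
    L2C_val (a *: L2C_expi_mul f xi) t + L2C_val (L2C_expi_mul f eta) t.
  by near: t; exact: L2C_valD.
have -> : L2C_val (a *: L2C_expi_mul f xi) t = a * L2C_val (L2C_expi_mul f xi) t.
  by near: t; exact: L2C_valZ.
have -> : L2C_val (L2C_expi_mul f xi) t = expi (L2R_val f t) * L2C_val xi t.
  by near: t; exact: L2C_val_expi_mul.
have -> : L2C_val (L2C_expi_mul f eta) t = expi (L2R_val f t) * L2C_val eta t.
  by near: t; exact: L2C_val_expi_mul.
by rewrite mulrDr mulrCA.
Unshelve. all: by end_near. Qed.

Lemma L2C_expi_mulD (f g : L2R R) :
  L2C_expi_mul (f + g) = L2C_expi_mul f \o L2C_expi_mul g.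
Proof.
apply/funext => xi /=; apply: L2C_val_inj.
near=> t.
have -> : L2C_val (L2C_expi_mul (f + g) xi) t =
    expi (L2R_val (f + g) t) * L2C_val xi t.
  by near: t; exact: L2C_val_expi_mul.
have -> : L2R_val (f + g) t = L2R_val f t + L2R_val g t.
  by near: t; exact: L2R_valD.
have -> : L2C_val (L2C_expi_mul f (L2C_expi_mul g xi)) t =
    expi (L2R_val f t) * L2C_val (L2C_expi_mul g xi) t.
  by near: t; exact: L2C_val_expi_mul.
have -> : L2C_val (L2C_expi_mul g xi) t = expi (L2R_val g t) * L2C_val xi t.
  by near: t; exact: L2C_val_expi_mul.
by rewrite expiD mulrA.
Unshelve. all: by end_near. Qed.

Lemma L2C_expi_mul0 : L2C_expi_mul (0 : L2R R) = id.
Proof.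
apply/funext => xi; apply: L2C_val_inj.
near=> t.
have -> : L2C_val (L2C_expi_mul 0 xi) t = expi (L2R_val 0 t) * L2C_val xi t.
  by near: t; exact: L2C_val_expi_mul.
have -> : L2R_val (0 : L2R R) t = 0 by near: t; exact: L2R_val0.
by rewrite expi0 mul1r.
Unshelve. all: by end_near. Qed.

Lemma measurable_complex_conj (f : T -> R[i]) :
  measurable_complex f -> measurable_complex (fun t => (f t)^*%C).
Proof.
move=> [mr mi]; split.
  rewrite (_ : _ \o _ = @complex.Re R \o f)//.
  by apply/funext => t /=; case: (f t).
rewrite (_ : _ \o _ = \- (@complex.Im R \o f)); first exact: measurableT_comp.
by apply/funext => t /=; case: (f t).
Qed.

Lemma L2C_expi_mul_inner (f : L2R R) (xi eta : L2C R) :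
  L2C_inner (L2C_expi_mul f xi) (L2C_expi_mul f eta) = L2C_inner xi eta.
Proof.
have ae : {ae @mu01 R, forall t : T,
    L2C_val (L2C_expi_mul f xi) t * ((L2C_val (L2C_expi_mul f eta) t)^*)%C =
    L2C_val xi t * ((L2C_val eta t)^*)%C}.
  near=> t.
  have -> : L2C_val (L2C_expi_mul f xi) t = expi (L2R_val f t) * L2C_val xi t.
    by near: t; exact: L2C_val_expi_mul.
  have -> : L2C_val (L2C_expi_mul f eta) t = expi (L2R_val f t) * L2C_val eta t.
    by near: t; exact: L2C_val_expi_mul.
  (* Grouping e^{if} with its conjugate leaves the factor cos^2 + sin^2 = 1. *)
  rewrite rmorphM mulrACA /=.
  rewrite [X in X * _](_ : _ = 1) ?mul1r//.
  apply/eqP; rewrite eq_complex /= mulrN opprK -!expr2 cos2Dsin2 eqxx /=.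
  by rewrite mulrN mulrC addNr.
have m (u v : L2C R) :
    measurable_complex (fun t : T => L2C_val u t * ((L2C_val v t)^*)%C).
  apply: measurable_complexM; first exact: L2C_val_measurable.
  exact/measurable_complex_conj/L2C_val_measurable.
have [mr mi] := m xi eta.
have [mr' mi'] := m (L2C_expi_mul f xi) (L2C_expi_mul f eta).
rewrite /L2C_inner /Rintegral; congr (fine _ +i* fine _)%C.
  apply: ae_eq_integral => //; [exact/measurable_EFinP|exact/measurable_EFinP|].
  by apply: filterS ae => t e _ /=; rewrite e.
apply: ae_eq_integral => //; [exact/measurable_EFinP|exact/measurable_EFinP|].
by apply: filterS ae => t e _ /=; rewrite e.
Unshelve. all: by end_near. Qed.

Lemma L2C_expi_mul_unitary_rep : unitary_rep (@L2C_expi_mul R).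
Proof.
split=> [f|]; last exact: L2C_expi_mulD.
split; [exact: L2C_expi_mul_linear| |exact: L2C_expi_mul_inner].
(* The inverse is multiplication by e^{-if}, by the homomorphism property. *)
exists (L2C_expi_mul (- f)) => xi.
  by rewrite -[LHS]/((_ \o _) xi) -L2C_expi_mulD addNr L2C_expi_mul0.
by rewrite -[LHS]/((_ \o _) xi) -L2C_expi_mulD subrr L2C_expi_mul0.
Qed.

End UnitaryRep.

(** * Norm comparison and truncation in L^2 *)

Section L2Norm.
Variable R : realType.
Local Notation T := (measurableTypeR R).
Implicit Types (u v : L2R_fun R) (xi eta : L2C R).

Lemma L2R_snorm_le u v : {ae @mu01 R, forall t : T, `|u t| <= `|v t|} ->
  L2R_snorm u <= L2R_snorm v.
Proof. by move=> uv; rewrite -lee_fin !finite_norm_fine; exact: ae_le_Lnorm2. Qed.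

Lemma L2R_snorm_sqr u :
  ((L2R_snorm u ^+ 2)%:E = \int[@mu01 R]_t (u t ^+ 2)%:E)%E.
Proof.
have snorm_ge0 : 0 <= L2R_snorm u by rewrite fine_ge0// Lnorm_ge0.
rewrite -powR_mulrn// -poweR_EFin finite_norm_fine powR_Lnorm ?pnatr_eq0//.
apply: eq_integral => t _ /=; congr (_%:E).
by rewrite powR_mulrn// real_normK// num_real.
Qed.

Lemma dominated_Lfun2 (g : T -> R) v : measurable_fun setT g ->
  (forall t, `|g t| <= `|v t|) -> g \in Lfun (@mu01 R) 2%:R%:E.
Proof.
move=> mg gv; apply/andP; split; apply/mem_set => //.
by apply: le_lt_trans (le_Lnorm2 _ _ gv) _ => //; exact: Lfunction_finite.
Qed.

(** Reduces estimates for the [R[i]]-valued norm of [L2C R] to real functions. *)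
Definition L2C_modulus xi : L2R_fun R := L2_modulus (L2C_funP (snrepr xi)).

Lemma L2C_modulusE xi t : L2C_modulus xi t = normc (L2C_val xi t).
Proof. by []. Qed.

Lemma L2C_normE xi : `|xi| = (L2R_snorm (L2C_modulus xi))%:C%C.
Proof. by []. Qed.

Lemma L2R_tail u e : 0 < e -> exists M v,
  [/\ 0 <= M, L2R_snorm v < e, forall t, 0 <= v t &
      forall t, M < `|u t| -> v t = `|u t|].
Proof.
move=> e0.
pose w (n : nat) (t : T) : R := `|u t| * \1_[set s | n%:R < `|u s|] t.
have mu_ : measurable_fun setT (fun t => `|u t|) by exact: measurableT_comp.
have mset n : measurable [set s : T | n%:R < `|u s|].
  rewrite -[X in measurable X]setTI.
  exact: (measurable_fun_ltr (measurable_cst _) mu_) => //.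
have mw n : measurable_fun setT (w n).
  by apply: measurable_funM => //; exact: measurable_indic.
have wu n t : `|w n t| <= `|u t|.
  rewrite /w normrM normr_id ler_piMr// ger0_norm// indicE; by case: (_ \in _).
pose v n : L2R_fun R := Lfun_Sub (lee1n 2) (dominated_Lfun2 (mw n) (wu n)).
have iu : (@mu01 R).-integrable setT (EFin \o (fun t => u t ^+ 2)).
  by apply: Lfun2_integrable_sqr; exact: valP.
have mw2 n : measurable_fun setT (fun t => (w n t ^+ 2)%:E).
  by apply/measurable_EFinP; exact: measurable_funX.
have w0 (t : T) : (w n t ^+ 2)%:E @[n --> \oo] --> 0%E.
  (* For fixed [t] the sequence vanishes as soon as n >= |u t|. *)
  apply: cvg_near_cst; near=> n; congr (_%:E).
  rewrite /w indicE memNset ?mulr0 ?expr0n//=; apply/negP; rewrite -leNgt.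
  by near: n; exact: nbhs_infty_ger.
have wle : {ae @mu01 R, forall t n, setT t ->
    (`|(w n t ^+ 2)%:E| <= (u t ^+ 2)%:E)%E}.
  apply: nearW => t n _; rewrite /= lee_fin normrX.
  by rewrite -[leRHS]real_normK ?num_real// ler_sqr ?nnegrE.
have w0ae : {ae @mu01 R, forall t, setT t ->
    (w n t ^+ 2)%:E @[n --> \oo] --> 0%E} by apply: nearW.
have [_ _] := dominated_convergence measurableT mw2 (measurable_cst 0%E)
  w0ae iu wle.
(* The integrals are squared norms, hence the tolerance e^2; the index [n] found here also serves as
   the threshold [M]. *)
rewrite integral0 => /fine_cvgP[_] /cvgrPdist_lt /(_ (e ^+ 2)).
rewrite exprn_gt0// => /(_ isT) [n _ /(_ n (leqnn n))] /=.
rewrite -(L2R_snorm_sqr (v n)) /= sub0r normrN normrX.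
have vn0 : 0 <= L2R_snorm (v n) by rewrite fine_ge0// Lnorm_ge0.
rewrite ltr_sqr ?nnegrE ?(ltW e0)// ger0_norm// => vne.
exists n%:R, (v n); split => // t; first by rewrite /= /w mulr_ge0.
by move=> ut; rewrite /= /w indicE mem_set//= mulr1.
Unshelve. all: by end_near. Qed.

Lemma ae_ler_L2C_norm xi eta :
  {ae @mu01 R, forall t : T, normc (L2C_val xi t) <= normc (L2C_val eta t)} ->
  `|xi| <= `|eta|.
Proof.
move=> le; rewrite !L2C_normE lecR; apply: L2R_snorm_le.
by apply: filterS le => t; rewrite !L2C_modulusE !ger0_norm// normc_ge0.
Qed.

End L2Norm.

(** * Joint continuity of the action *)

Section ContinuousRep.
Variable R : realType.
Local Notation T := (measurableTypeR R).
Implicit Types (f g : L2R R) (xi eta : L2C R).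

Lemma L2C_expi_mul_norm f xi : `|L2C_expi_mul f xi| = `|xi|.
Proof.
have e : {ae @mu01 R, forall t : T,
    normc (L2C_val (L2C_expi_mul f xi) t) = normc (L2C_val xi t)}.
  apply: filterS (L2C_val_expi_mul f xi) => t ->.
  by rewrite normcM normc_expi mul1r.
by apply/eqP; rewrite eq_le; apply/andP; split; apply: ae_ler_L2C_norm;
  apply: filterS e => t ->.
Qed.

Lemma L2C_expi_mulB f xi eta :
  L2C_expi_mul f (xi - eta) = L2C_expi_mul f xi - L2C_expi_mul f eta.
Proof.
by rewrite -scaleN1r addrC [LHS]L2C_expi_mul_linear scaleN1r addrC.
Qed.

Lemma L2C_expi_mul_dist f g xi M (v : L2R_fun R) : 0 <= M ->
  (forall t, 0 <= v t) ->
  (forall t, M < normc (L2C_val xi t) -> v t = normc (L2C_val xi t)) ->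
  `|L2C_expi_mul f xi - L2C_expi_mul g xi| <=
    (M * `|f - g| + 2 * L2R_snorm v)%:C%C.
Proof.
move=> M0 v0 vxi; rewrite L2C_normE lecR.
have mh : measurable_fun setT (fun t : T => `|L2R_val (f - g) t|).
  by apply: measurableT_comp => //; exact: L2R_val_measurable.
have hle t : `| `|L2R_val (f - g) t| | <= `|(snrepr (f - g) : L2R_fun R) t|.
  by rewrite normr_id.
pose h : L2R_fun R := Lfun_Sub (lee1n 2) (dominated_Lfun2 mh hle).
(* The pointwise majorant is M |f - g| + 2 v; its norm is bounded by the triangle inequality. *)
apply: (@le_trans _ _ (L2R_snorm (M *: h + 2 *: v))); last first.
  apply: le_trans (snormD (L2R_seminorm R) _ _) _.
  rewrite [X in X + _](snormZ (L2R_seminorm R)).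
  rewrite [X in _ + X](snormZ (L2R_seminorm R)) /=.
  rewrite (ger0_norm M0) ger0_norm// lerD// ler_wpM2l//.
  by apply: (@L2R_snorm_le R h (snrepr (f - g))); apply: nearW => t; exact: hle.
apply: L2R_snorm_le; near=> t.
rewrite L2C_modulusE.
(* Factoring out e^{ig}, of modulus 1, leaves only the difference f - g. *)
have -> : L2C_val (L2C_expi_mul f xi - L2C_expi_mul g xi) t =
    (expi (L2R_val (f - g) t) - 1) * (expi (L2R_val g t) * L2C_val xi t).
  have -> : L2C_val (L2C_expi_mul f xi - L2C_expi_mul g xi) t =
      L2C_val (L2C_expi_mul f xi) t + L2C_val (- L2C_expi_mul g xi) t.
    by near: t; exact: L2C_valD.
  have -> : L2C_val (- L2C_expi_mul g xi) t = - L2C_val (L2C_expi_mul g xi) t.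
    by near: t; exact: L2C_valN.
  have -> : L2C_val (L2C_expi_mul g xi) t = expi (L2R_val g t) * L2C_val xi t.
    by near: t; exact: L2C_val_expi_mul.
  have -> : L2C_val (L2C_expi_mul f xi) t = expi (L2R_val f t) * L2C_val xi t.
    by near: t; exact: L2C_val_expi_mul.
  have : L2R_val (f - g + g) t = L2R_val (f - g) t + L2R_val g t.
    by near: t; exact: L2R_valD.
  by rewrite subrK => ->; rewrite expiD mulrBl mul1r mulrA.
rewrite !normcM normc_expi mul1r (ger0_norm (mulr_ge0 _ _)) ?normc_ge0//.
have -> : (M *: h + 2 *: v) t = M * `|L2R_val (f - g) t| + 2 * v t by [].
rewrite [leRHS]ger0_norm; last by rewrite addr_ge0// mulr_ge0.
(* Where |xi| <= M the bound |e^{ix} - 1| <= |x| is absorbed by the first summand; elsewhere v =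
   |xi| and |e^{ix} - 1| <= 2 is absorbed by the second. *)
have [xiM|xiM] := leP (normc (L2C_val xi t)) M.
  rewrite -[leLHS]addr0 lerD//; last by rewrite mulr_ge0.
  by rewrite mulrC ler_pM ?normc_ge0 ?normc_expiB1.
rewrite vxi// -[leLHS]add0r lerD//; first by rewrite mulr_ge0.
by rewrite ler_wpM2r ?normc_ge0 ?normc_expiB1_le2.
Unshelve. all: by end_near. Qed.

Lemma L2C_expi_mul_continuous_rep : continuous_rep (@L2C_expi_mul R).
Proof.
move=> [g xi]; apply/cvgrPdist_lt => e e0 /=.
(* In the order of [R[i]], a positive element has zero imaginary part, so [e] is a real radius. *)
have [r0 eE] : 0 < complex.Re e /\ e = (complex.Re e)%:C%C.
  by move: e e0 => [a b]; rewrite ltcE /= => /andP[/eqP -> a0].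
move: (complex.Re e) r0 eE => r r0 {e e0} ->.
(* The tail enters doubled, so r/8 costs r/4; moving the group element costs another r/4, and r/2
   remains for moving the vector. *)
have [M [v [M0 vr v0 vxi]]] :=
  L2R_tail (L2C_modulus xi) (divr_gt0 r0 (ltr0n R 8)).
have vxi' t : M < normc (L2C_val xi t) -> v t = normc (L2C_val xi t).
  by have := vxi t; rewrite L2C_modulusE ger0_norm ?normc_ge0.
(* M + 1 rather than M in the denominator, since M may be 0. *)
have d0 : 0 < r / (4 * (M + 1)) by rewrite divr_gt0// mulr_gt0// ltr_wpDl.
have rd : M * (r / (4 * (M + 1))) <= r / 4.
  have M1 : 0 < M + 1 by rewrite ltr_wpDl.
  have -> : M * (r / (4 * (M + 1))) = r / 4 * (M / (M + 1)).
    by field; rewrite gt_eqF.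
  have r4 : 0 <= r / 4 by rewrite ltW// divr_gt0.
  by rewrite ler_piMr// ler_pdivrMr// mul1r lerDl.
have r2 : 0 < (r / 2)%:C%C by rewrite ltcR divr_gt0.
have c1 : (fun p : L2R R * L2C R => p.1) @ (g, xi) --> g by exact: cvg_fst.
have c2 : (fun p : L2R R * L2C R => p.2) @ (g, xi) --> xi by exact: cvg_snd.
near=> p.
have p1 : `|g - p.1| < r / (4 * (M + 1)).
  by near: p; move/cvgrPdist_lt: c1; exact.
have p2 : `|xi - p.2| < (r / 2)%:C%C.
  by near: p; move/cvgrPdist_lt: c2; exact.
(* Inserting e^{i p.1} xi separates the two variables; the vector part is handled by isometry of the
   action. *)
rewrite -(subrK (L2C_expi_mul p.1 xi) (L2C_expi_mul g xi)) -addrA.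
rewrite -L2C_expi_mulB (le_lt_trans (ler_normD _ _))// L2C_expi_mul_norm.
rewrite (_ : r = r / 2 + r / 2) ?rmorphD ?ler_ltD//; last by rewrite -splitr.
apply: le_trans (L2C_expi_mul_dist g p.1 M0 v0 vxi') _.
rewrite lecR; have := ler_wpM2l M0 (ltW p1); lra.
Unshelve. all: by end_near. Qed.

End ContinuousRep.

(** * Triviality of the smooth vectors *)

Section SmoothVectors.
Variable R : realType.
Local Notation T := (measurableTypeR R).
Local Notation mu := (@mu01 R).
Implicit Types (f g : L2R R) (xi eta : L2C R).

Lemma mu01E (A : set T) : mu A = lebesgue_measure (A `&` `[0, 1]%classic).
Proof. by []. Qed.

Lemma mu01_itv_le (a b : R) : a <= b -> (mu `[a, b]%classic <= (b - a)%:E)%E.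
Proof.
move=> ab; apply: (@le_trans _ _ (lebesgue_measure `[a, b]%classic)).
  by apply: le_measure; rewrite ?inE//; exact: measurableI.
rewrite lebesgue_measure_itv /= lte_fin; case: ifPn => // _.
by rewrite lee_fin subr_ge0.
Qed.

(** Repeated bisection of [0, 1], always keeping a half that meets [B] in positive measure; the
    interval length bounds the measure of the piece. *)
Lemma exists_small_subset (B : set T) (e : R) : measurable B ->
  (0 < mu B)%E -> 0 < e ->
  exists A : set T, [/\ measurable A, A `<=` B & (0 < mu A <= e%:E)%E].
Proof.
move=> mB B0 e0.
have mI a d : measurable (B `&` `[a, a + d]%classic).
  by apply: measurableI => //; exact: measurable_itv.
have bisect n : exists a, (0 < mu (B `&` `[a, (a + 2 ^- n)%R]%classic))%E.
  elim: n => [|n [a an]].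
    exists 0; rewrite expr0 invr1 add0r.
    by rewrite mu01E -setIA setIid.
  set d := 2 ^- n.+1.
  have dn : 2 ^- n = d + d by rewrite /d exprS invfM mulrC -splitr.
  have d0 : 0 < d by rewrite invr_gt0 exprn_gt0.
  rewrite dn addrA in an.
  have [a0|a0] := eqVneq (mu (B `&` `[a, a + d]%classic)) 0%E; last first.
    by exists a; rewrite lt0e a0 measure_ge0.
  have [b0|b0] := eqVneq (mu (B `&` `[a + d, a + d + d]%classic)) 0%E; last first.
    by exists (a + d); rewrite lt0e b0 measure_ge0.
  (* If both halves met [B] in null sets, so would their union, against the induction hypothesis. *)
  have U0 := null_set_setU (mI _ _) (mI _ _) a0 b0.
  move: an; rewrite ltNge -U0 => /negP[]; apply: le_measure; rewrite ?inE//.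
  - by apply: measurableI => //; exact: measurable_itv.
  - exact: measurableU.
  move=> t /= [Bt]; rewrite !in_itv /= => /andP[at_ tb].
  have [td|td] := leP t (a + d); [left|right]; split => //.
    by rewrite at_.
  by rewrite (ltW td) tb.
have [n en] : exists n, 2 ^- n <= e.
  (* Archimedes gives n > 1/e, and 2^n > n. *)
  exists (Num.bound e^-1).
  rewrite -[leRHS]invrK lef_pV2 ?posrE ?exprn_gt0 ?invr_gt0//.
  apply: le_trans (ltW (archi_boundP _)) _; first by rewrite invr_ge0 ltW.
  by rewrite -natrX ler_nat ltnW// ltn_expl.
have [a an] := bisect n.
exists (B `&` `[a, a + 2 ^- n]%classic); split => //.
rewrite an /=; apply: (@le_trans _ _ (mu `[a, a + 2 ^- n]%classic)).
  by apply: le_measure; rewrite ?inE//; exact: measurable_itv.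
apply: le_trans (mu01_itv_le _) _; first by rewrite lerDl invr_ge0 exprn_ge0.
by rewrite addrAC subrr add0r lee_fin.
Qed.

Lemma indic_Lfun2 (A : set T) : measurable A -> (mu A < +oo)%E ->
  (\1_A : T -> R) \in Lfun mu 2%:R%:E.
Proof.
move=> mA Aoo; apply/andP; split; apply/mem_set; first exact: measurable_indic.
rewrite /= /finite_norm unlock; apply: poweR_lty.
rewrite (_ : integral _ _ _ = mu A)//.
transitivity (\int[mu]_t (\1_A t)%:E)%E; last by rewrite integral_indic// setIT.
apply: eq_integral => t _ /=.
by rewrite indicE; case: (_ \in _); rewrite ?normr1 ?powR1// normr0 powR0.
Qed.

(** Otherwise |xi| < 1/(n+1) almost everywhere for each n; countably many null sets have null union,
    so xi = 0 almost everywhere. *)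
Lemma L2C_neq0_ge_on_pos_measure xi : xi != 0 -> exists d, 0 < d /\
  (0 < mu [set t : T | (d <= normc (L2C_val xi t))%R])%E.
Proof.
move=> xi0; apply: contrapT => nd; case/eqP: xi0; apply: L2C_val_inj.
have mxi : measurable_fun setT (fun t : T => normc (L2C_val xi t)).
  exact: (measurable_normc (L2C_val_measurable xi)).
have ae n : {ae mu, forall t : T, normc (L2C_val xi t) < n.+1%:R^-1}.
  have m : measurable [set t : T | n.+1%:R^-1 <= normc (L2C_val xi t)].
    rewrite -[X in measurable X]setTI.
    exact: (measurable_fun_ler (measurable_cst _) mxi).
  exists [set t : T | n.+1%:R^-1 <= normc (L2C_val xi t)]; split => //.
    apply/eqP; apply: contra_notT nd => n0; exists n.+1%:R^-1.
    by rewrite invr_gt0 ltr0n lt0e n0 measure_ge0.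
  by move=> t /= /negP; rewrite -leNgt.
apply: filterS2 (L2C_val0 R) (ae_foralln ae) => t -> xin.
apply: eq0_normc; apply/eqP; rewrite eq_le normc_ge0 andbT leNgt.
apply/negP => x0.
have := xin (Num.bound (normc (L2C_val xi t))^-1).
rewrite -[ltLHS]invrK ltf_pV2 ?posrE ?invr_gt0// => /lt_trans.
move=> /(_ _ (archi_boundP _)); rewrite invr_ge0 normc_ge0 => /(_ isT).
by rewrite ltr_nat ltnNge leqnSn.
Qed.

Lemma differentiable0_L2C_expi_mul_eq0 xi :
  differentiable (fun g => L2C_expi_mul g xi : realified (L2C R)) (0 : L2R R) ->
  xi = 0.
Proof.
pose F : L2R R -> realified (L2C R) := fun g => L2C_expi_mul g xi.
move=> dF; have {dF} : differentiable F (0 : L2R R) by [].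
move=> /diff_locally /eqaddoP Fo; apply/eqP; apply/negP => /negP xi0.
have [d [d0 B0]] := L2C_neq0_ge_on_pos_measure xi0.
have pi0 : 0 < pi :> R := pi_gt0 R.
(* With |h| = pi |1_A|, this tolerance bounds the second difference by 2 d |1_A|, half of the lower
   bound 4 d |1_A|. *)
have {Fo} := Fo (d / pi) (divr_gt0 d0 pi0).
move=> /nbhs_norm0P[r /= r0 Fr].
have {Fr} FrE y : `|y| < r -> `|F y - (F 0 + 'd F 0 y)| <= d / pi * `|y|.
  by move=> yr; rewrite -[y in F y]addr0; exact: Fr.
have mB : measurable [set t : T | d <= normc (L2C_val xi t)].
  rewrite -[X in measurable X]setTI.
  apply: (measurable_fun_ler (measurable_cst _)) => //.
  exact: (measurable_normc (L2C_val_measurable xi)).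
(* Since |1_A|^2 is the measure of A, this bound forces |h| <= r/2 < r. *)
have e0 : 0 < (r / (2 * pi)) ^+ 2 by rewrite exprn_gt0// divr_gt0// mulr_gt0.
have [A [mA AB /andP[A0 Ae]]] := exists_small_subset mB B0 e0.
pose iA : L2R_fun R :=
  Lfun_Sub (lee1n 2) (indic_Lfun2 mA (le_lt_trans Ae (ltry _))).
have iA_sqr : ((L2R_snorm iA ^+ 2)%:E = mu A)%E.
  rewrite L2R_snorm_sqr.
  transitivity (\int[mu]_t (\1_A t)%:E)%E; last by rewrite integral_indic// setIT.
  by apply: eq_integral => t _ /=; rewrite indicE; case: (_ \in _);
    rewrite ?expr1n// expr0n.
have s_ge0 : 0 <= L2R_snorm iA by rewrite fine_ge0// Lnorm_ge0.
have s0 : 0 < L2R_snorm iA.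
  rewrite lt_neqAle s_ge0 andbT eq_sym; apply: contraTneq A0 => s0.
  by rewrite -iA_sqr s0 expr0n ltxx.
have sr : L2R_snorm iA <= r / (2 * pi).
  rewrite -ler_sqr ?nnegrE//; last by rewrite ltW// divr_gt0// mulr_gt0.
  by rewrite -lee_fin iA_sqr.
pose h : L2R R := snpi (L2R_seminorm R) (pi *: iA).
have hnorm : `|h| = pi * L2R_snorm iA.
  rewrite [LHS](snorm_repr_pi (L2R_seminorm R)).
  by rewrite (snormZ (L2R_seminorm R)) gtr0_norm.
have hr : `|h| < r.
  rewrite hnorm; apply: le_lt_trans (_ : pi * (r / (2 * pi)) < r).
    by rewrite ler_wpM2l// ltW.
  have halve (p q : R) : p != 0 -> p * (q / (2 * p)) = q / 2.
    by move=> p0; field.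
  rewrite halve ?gt_eqF//.
  by rewrite ltr_pdivrMr// ltr_pMr// ltr1n.
pose S : realified (L2C R) := F h + F (- h) - (F 0 + F 0).
have S_le : `|S| <= 2 * (d * L2R_snorm iA).
  (* The derivative is odd, so the first-order terms at h and -h cancel, leaving two remainders. *)
  have -> : S = (F h - (F 0 + 'd F 0 h)) + (F (- h) - (F 0 + 'd F 0 (- h))).
    rewrite linearN opprD addrACA -!opprD /S; congr (_ - _).
    by rewrite addrACA subrr addr0.
  have F1 := FrE _ hr; have F2 := FrE (- h); rewrite normrN in F2.
  apply: le_trans (ler_normD _ _) _; rewrite mulr2n mulrDl mul1r.
  have <- : d / pi * `|h| = d * L2R_snorm iA by rewrite hnorm mulrA divfK ?gt_eqF.
  by rewrite lerD// F2.
have S_ge : 4 * d * L2R_snorm iA <= `|S|.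
  have -> : 4 * d * L2R_snorm iA = L2R_snorm ((4 * d) *: iA).
    by rewrite L2R_snormZ gtr0_norm// mulr_gt0.
  (* It suffices that 4 d 1_A <= |S| pointwise; on A both exponentials equal -1, so S = -4 xi there,
     and |xi| >= d. *)
  apply: (@L2R_snorm_le R ((4 * d) *: iA) (L2C_modulus S)); near=> t.
  have -> : ((4 * d) *: iA) t = 4 * d * \1_A t by [].
  rewrite L2C_modulusE indicE.
  have [tA|tA] := boolP (t \in A); last by rewrite mulr0 normr0.
  have -> : L2C_val S t = (- 4)%:C%C * L2C_val xi t.
    have -> : L2C_val S t =
        L2C_val (F h + F (- h) : L2C R) t + L2C_val (- (F 0 + F 0) : L2C R) t.
      by near: t; exact: L2C_valD.
    have -> : L2C_val (F h + F (- h) : L2C R) t =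
        L2C_val (F h) t + L2C_val (F (- h)) t.
      by near: t; exact: L2C_valD.
    have -> : L2C_val (- (F 0 + F 0) : L2C R) t = - L2C_val (F 0 + F 0 : L2C R) t.
      by near: t; exact: L2C_valN.
    have -> : L2C_val (F 0 + F 0 : L2C R) t = L2C_val (F 0) t + L2C_val (F 0) t.
      by near: t; exact: L2C_valD.
    have -> : L2C_val (F h) t = expi (L2R_val h t) * L2C_val xi t.
      by near: t; exact: L2C_val_expi_mul.
    have -> : L2C_val (F (- h)) t = expi (L2R_val (- h) t) * L2C_val xi t.
      by near: t; exact: L2C_val_expi_mul.
    have -> : F 0 = xi by rewrite /F L2C_expi_mul0.
    have -> : L2R_val (- h) t = - L2R_val h t by near: t; exact: L2R_valN.
    have -> : L2R_val h t = (pi *: iA) t by near: t; exact: L2R_val_pi.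
    have -> : (pi *: iA) t = pi.
      by rewrite -[RHS]mulr1 -[X in _ * X]/(true%:R) -tA.
    have expipi : expi pi = - 1 :> R[i].
      by rewrite /expi cospi sinpi; apply/eqP; rewrite eq_complex /= oppr0 !eqxx.
    have expiNpi : expi (- pi) = - 1 :> R[i].
      rewrite /expi cosN sinN cospi sinpi; apply/eqP.
      by rewrite eq_complex /= oppr0 !eqxx.
    rewrite expipi expiNpi rmorphN rmorph_nat; ring.
  rewrite normcM mulr1 !ger0_norm ?mulr_ge0 ?normc_ge0 ?(ltW d0)//.
  have -> : normc ((- 4)%:C)%C = 4 :> R.
    by rewrite Defs.normcE /= expr0n addr0 sqrtr_sqr normrN ger0_norm.
  by rewrite ler_pM2l//; apply: AB; rewrite -inE.
have := le_trans S_ge S_le.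
by rewrite mulrA ler_pM2r// ler_pM2r// ler_nat.
Unshelve. all: by end_near. Qed.

(** Induction with [F] general, because the derivative of the zero map is the zero map into
    [clin E F]. *)
Lemma Cn_cst0 (E F : normedModType R) n : Cn n (cst 0 : E -> F).
Proof.
elim: n F => [|n IHn] F /=; first exact: cst_continuous.
split=> [x|]; first exact: differentiable_cst.
rewrite (_ : fderiv _ = cst 0)//; apply/funext => x; apply/val_inj.
by rewrite /= fderivE ?diff_cst//; exact: differentiable_cst.
Qed.

End SmoothVectors.

Theorem theorem2p3 (R : realType) :
  [/\ unitary_rep (@L2C_expi_mul R),
      continuous_rep (@L2C_expi_mul R) &
      smooth_vectors (@L2C_expi_mul R) = [set 0]].
Proof.
split; [exact: L2C_expi_mul_unitary_rep|exact: L2C_expi_mul_continuous_rep|].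
(* Smoothness at level 1 yields differentiability at 0. Conversely, the orbit map of the zero vector
   is constantly 0. *)
apply/seteqP; split => [xi /(_ 1%N)[dF _]|_ ->] /=.
  by apply: differentiable0_L2C_expi_mul_eq0; exact: dF.
move=> n; rewrite (_ : (fun g => _) = cst 0); first exact: Cn_cst0.
apply/funext => g /=; have := L2C_expi_mulB g 0 0.
by rewrite !subrr.
Qed.
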